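(* Let $A\in\mathbb{R}^{n\times n}$, $B\in\mathbb{R}^{n\times m}$, $C\in\mathbb{R}^{k\times n}$, where $A$ is stable, $(A,B)$ is controllable, $(C,A)$ is observable, $B$ has full column rank and $C$ has full row rank. If $\alpha>0$ and a symmetric matrix $Q_\alpha\succ 0$ are such that $$Q_\alpha A+A^\top Q_\alpha+\alpha Q_\alpha+\frac1\alpha C^\top C=0,$$ then $$\{x\in\mathbb{R}^n \mid x^\top Q_\alpha x\le 1\}\subset \mathcal{O}_1.$$
   Context: A square real matrix is called stable if all its eigenvalues have strictly negative real parts. $|\cdot|$ is the Euclidean norm. For $T\ge 0$ let $\mathcal{O}_1(T)$ be the set of all $x_0\in\mathbb{R}^n$ such that the output $y(t)=Cx(t)$ of $\dot x=Ax$, $x(0)=x_0$ (that is, $y(t)=Ce^{At}x_0$) satisfies $\int_0^T|y(t)|\,dt\le 1$. The hardly observable set with respect to the $1$-norm is $\mathcal{O}_1:=\bigcap_{T\ge 0}\mathcal{O}_1(T)$. *)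

(* Defs.v *)
From HB Require Import structures.
From mathcomp Require Import all_boot all_order all_algebra.
From mathcomp Require Import complex.
From mathcomp Require Import all_classical all_reals all_analysis.

Set Implicit Arguments.
Unset Strict Implicit.
Unset Printing Implicit Defensive.

Import Order.TTheory GRing.Theory Num.Theory.
Import numFieldNormedType.Exports.

Local Open Scope classical_set_scope.
Local Open Scope ring_scope.

(* The library norm [`|x|] on matrices is the max norm. *)
Definition eucl_norm (R : realType) (k : nat) (y : 'cV[R]_k) : R :=
  Num.sqrt (\sum_(i < k) y i ord0 ^+ 2).

Definition quad_form (R : realType) (n : nat) (Q : 'M[R]_n) (x : 'cV[R]_n) : R :=
  (x^T *m Q *m x) ord0 ord0.

Definition pos_def (R : realType) (n : nat) (Q : 'M[R]_n) : Prop :=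
  forall x : 'cV[R]_n, x != 0 -> 0 < quad_form Q x.

(* [eigenvalue] uses row eigenvectors; left and right spectra coincide. *)
Definition stable (R : realType) (n : nat) (A : 'M[R]_n) : Prop :=
  forall z : R[i], eigenvalue (map_mx (real_complex R) A) z -> complex.Re z < 0.

Definition expmx (R : realType) (n : nat) (A : 'M[R]_n) : 'M[R]_n :=
  limn (series (fun j : nat => (j`!%:R : R)^-1 *: A ^+ j)).

(* State at time T of x' = Ax + Bu, x(0) = x0, by variation of constants;
   the integral of a vector-valued function is taken entrywise. *)
Definition state (R : realType) (n m : nat) (A : 'M[R]_n) (B : 'M[R]_(n, m))
    (x0 : 'cV[R]_n) (u : R -> 'cV[R]_m) (T : R) : 'cV[R]_n :=
  expmx (T *: A) *m x0 +
  \col_(i < n) \int[lebesgue_measure]_(t in `[0, T])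
                  (expmx ((T - t) *: A) *m B *m u t) i ord0.

(* Steering between any two states in finite time, with integrable inputs. *)
Definition controllable (R : realType) (n m : nat)
    (A : 'M[R]_n) (B : 'M[R]_(n, m)) : Prop :=
  forall x0 x1 : 'cV[R]_n, exists (T : R) (u : R -> 'cV[R]_m),
    [/\ 0 < T,
        forall i : 'I_m,
          lebesgue_measure.-integrable `[0, T] (fun t => (u t i ord0)%:E)
      & state A B x0 u T = x1].

(* Output y(t) = C x(t) of the autonomous system x' = Ax, x(0) = x0. *)
Definition output (R : realType) (n k : nat) (C : 'M[R]_(k, n)) (A : 'M[R]_n)
    (x0 : 'cV[R]_n) (t : R) : 'cV[R]_k :=
  C *m expmx (t *: A) *m x0.

(* The output on [0, +oo) determines the initial state. A common known input
   would add the same term to both outputs, so the autonomous system is enough. *)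
Definition observable (R : realType) (n k : nat)
    (C : 'M[R]_(k, n)) (A : 'M[R]_n) : Prop :=
  forall x0 x1 : 'cV[R]_n,
    (forall t : R, 0 <= t -> output C A x0 t = output C A x1 t) -> x0 = x1.

Definition hardly_observable1_upto (R : realType) (n k : nat)
    (C : 'M[R]_(k, n)) (A : 'M[R]_n) (T : R) : set 'cV[R]_n :=
  [set x0 | (\int[lebesgue_measure]_(t in `[0%R, T])
               (eucl_norm (output C A x0 t))%:E <= 1)%E].

Definition hardly_observable1 (R : realType) (n k : nat)
    (C : 'M[R]_(k, n)) (A : 'M[R]_n) : set 'cV[R]_n :=
  \bigcap_(T in [set T : R | 0 <= T]) hardly_observable1_upto C A T.

(* Main.v *)
Require Import Defs.
From HB Require Import structures.
From mathcomp Require Import all_boot all_order all_algebra.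
From mathcomp Require Import complex.
From mathcomp Require Import all_classical all_reals all_analysis.
From mathcomp Require Import ring lra.
Import Order.TTheory GRing.Theory Num.Theory.
Import numFieldNormedType.Exports.
Local Open Scope classical_set_scope.
Local Open Scope ring_scope.

(** Along a trajectory x(t) = e^{At} x0, the function V(t) = x(t)^T Q x(t)
    satisfies, by the matrix equation,
      V' = - alpha V - |y|^2 / alpha,     that is,
      (e^{alpha t} V)' = - e^{alpha t} |y|^2 / alpha.
    So the output is controlled in a weighted L^2 norm, and the L^1 bound comes
    from splitting |y| = e^{- alpha t / 2} (e^{alpha t / 2} |y|). Instead of the
    Cauchy-Schwarz inequality on integrals, the proof uses its pointwise form
      |y| <= (alpha e^{- alpha t} + e^{alpha t} |y|^2 / alpha) / 2,
    whose right-hand side is the derivative of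
      - (e^{- alpha t} + e^{alpha t} V) / 2.
    Integrating over [0, T] and dropping the nonnegative terms at T gives
      int_0^T |y| <= (1 + V(0)) / 2 <= 1,
    since V(0) = x0^T Q x0 <= 1; this is [dissipation_integral_le].

    The differentiability of t |-> e^{At} is obtained entrywise: each entry of
    B e^{At} is a power series in t with coefficients (B A^j)_{pq} / j!
    ([mulmx_expmx_entryE]), dominated by an exponential series, and
    differentiating it term by term replaces B by B A ([is_derive_expmx]). *)

Set Implicit Arguments.
Unset Strict Implicit.
Unset Printing Implicit Defensive.

(** * The matrix exponential as a family of power series *)

Lemma normr_entry_exprmx_le (R : realType) (n : nat) (A : 'M[R]_n) (j : nat)
    (p q : 'I_n) :
  `|(A ^+ j) p q| <= (\sum_i \sum_l `|A i l|) ^+ j.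
Proof.
elim: j p q => [|j IHj] p q.
  by rewrite !expr0 mxE; case: (p == q); rewrite ?normr0 ?normr1.
have M0 : 0 <= \sum_i \sum_l `|A i l|.
  by apply: sumr_ge0 => i _; apply: sumr_ge0.
rewrite exprS mxE (le_trans (ler_norm_sum _ _ _))//.
apply: (@le_trans _ _ (\sum_l `|A p l| * (\sum_i \sum_l `|A i l|) ^+ j)).
  by apply: ler_sum => l _; rewrite normrM ler_wpM2l.
rewrite -mulr_suml exprS ler_wpM2r ?exprn_ge0//.
rewrite [leRHS](bigD1 p)//= lerDl.
by apply: sumr_ge0 => i _; apply: sumr_ge0.
Qed.

(** This covers [n = 0], where matrices form the zero ring, to which [exprZn]
    does not apply. *)
Lemma exprmxZ (R : comNzRingType) (n : nat) (A : 'M[R]_n) (t : R) (j : nat) :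
  (t *: A) ^+ j = t ^+ j *: A ^+ j.
Proof.
elim: j => [|j IHj]; first by rewrite !expr0 scale1r.
by rewrite !exprS IHj -!mulmxE -scalemxAl -scalemxAr scalerA.
Qed.

Lemma is_cvg_pseries_expmx (R : realType) (n : nat) (A : 'M[R]_n) (p q : 'I_n)
    (t : R) :
  cvgn (pseries (fun j => (j`!%:R)^-1 * (A ^+ j) p q) t).
Proof.
apply: (@normed_cvg _ R^o).
set M := \sum_i \sum_l `|A i l|.
apply: (@series_le_cvg _ _ (exp_coeff (M * `|t|)));
  last exact: is_cvg_series_exp_coeff.
- by move=> j; exact: normr_ge0.
- move=> j; rewrite /exp_coeff /= divr_ge0// exprn_ge0// mulr_ge0//.
  by apply: sumr_ge0 => i _; apply: sumr_ge0.
- move=> j; rewrite /exp_coeff /= [leRHS]mulrC !normrM normrV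
    ?unitfE ?pnatr_eq0 -?lt0n ?fact_gt0//.
  rewrite normr_nat -mulrA ler_wpM2l// exprMn normrX ler_wpM2r ?exprn_ge0//.
  exact: normr_entry_exprmx_le.
Qed.

(** Convergence of matrices is convergence of the entries, so the limit of the
    matrix series is the matrix of the sums of the scalar series. *)
Lemma expmx_entryE (R : realType) (n : nat) (A : 'M[R]_n) (t : R)
    (p q : 'I_n) :
  pseries (fun j => (j`!%:R)^-1 * (A ^+ j) p q) t @ \oo --> expmx (t *: A) p q.
Proof.
have entryE N i l :
    series (fun j : nat => (j`!%:R : R)^-1 *: (t *: A) ^+ j) N i l =
    pseries (fun j => (j`!%:R)^-1 * (A ^+ j) i l) t N.
  rewrite /pseries /series /= summxE; apply: eq_bigr => j _.
  by rewrite exprmxZ !mxE; ring.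
pose L : 'M[R]_n := \matrix_(i, l)
  limn (pseries (fun j => (j`!%:R)^-1 * (A ^+ j) i l) t).
suff H :
  series (fun j : nat => (j`!%:R : R)^-1 *: (t *: A) ^+ j) @ \oo --> L.
  rewrite /expmx (cvg_lim _ H) ?mxE; last exact: norm_hausdorff.
  exact: is_cvg_pseries_expmx.
apply/cvgrPdist_le => /= e e0; near=> N.
rewrite /Num.Def.normr/= mx_normrE (bigmax_le _ (ltW e0))//= => i _.
rewrite !mxE entryE; move: i; near: N; apply: filter_forall => /= i.
exact: ((cvgrPdist_le _ _).1 (@is_cvg_pseries_expmx R n A i.1 i.2 t)).
Unshelve. all: by end_near. Qed.

(** The factor [B] makes this family of power series closed under termwise
    differentiation, which turns [B] into [B *m A]. *)
Lemma mulmx_expmx_entryE (R : realType) (m n : nat) (A : 'M[R]_n)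
    (B : 'M[R]_(m, n)) (t : R) (p : 'I_m) (q : 'I_n) :
  pseries (fun j => (j`!%:R)^-1 * (B *m A ^+ j) p q) t @ \oo
    --> (B *m expmx (t *: A)) p q.
Proof.
rewrite mxE.
have -> : pseries (fun j => (j`!%:R)^-1 * (B *m A ^+ j) p q) t =
    fun N => \sum_r
      B p r * pseries (fun j => (j`!%:R)^-1 * (A ^+ j) r q) t N.
  apply/funext => N; rewrite /pseries /series /=.
  under [RHS]eq_bigr do rewrite mulr_sumr.
  rewrite exchange_big /=; apply: eq_bigr => j _.
  rewrite mxE mulr_sumr mulr_suml; apply: eq_bigr => r _; ring.
apply: cvg_big => [|r _]; first by move=> *; exact: add_continuous.
by apply: cvgMl_tmp; exact: expmx_entryE.
Qed.

(** Termwise differentiation shifts the coefficients [(A ^+ j) p q / j!] by one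
    index, which multiplies the matrices by [A]; since the shifted series are of
    the same kind, they converge everywhere. *)
Lemma is_derive_expmx (R : realType) (n : nat) (A : 'M[R]_n) (t : R)
    (p q : 'I_n) :
  is_derive t 1 (fun s => expmx (s *: A) p q) ((A *m expmx (t *: A)) p q).
Proof.
pose c (B : 'M[R]_n) j : R := (j`!%:R)^-1 * (B *m A ^+ j) p q.
have cE B s : limn (pseries (c B) s) = (B *m expmx (s *: A)) p q.
  exact/cvg_lim/mulmx_expmx_entryE.
have cvgc B s : cvgn (pseries (c B) s).
  apply/cvg_ex; exists ((B *m expmx (s *: A)) p q).
  exact: mulmx_expmx_entryE.
have diffc B : pseries_diffs (c B) = c (B *m A).
  apply/funext => j; rewrite /pseries_diffs /c factS natrM invfM !mulrA.
  by rewrite divff ?pnatr_eq0// mul1r exprS -mulmxE mulmxA.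
have -> : (fun s => expmx (s *: A) p q) =
    (fun s => limn (pseries (c 1%:M) s)).
  by apply/funext => s; rewrite cE mul1mx.
have -> : A *m expmx (t *: A) = 1%:M *m A *m expmx (t *: A).
  by rewrite mul1mx.
rewrite -cE -diffc.
(* Any point farther from 0 than t serves as the comparison radius. *)
apply: (@pseries_snd_diffs _ _ (`|t| + 1)); rewrite ?diffc//.
by rewrite [ltRHS]ger0_norm ?addr_ge0// ltrDl.
Qed.

Lemma expmx0 (R : realType) (n : nat) : expmx (0 : 'M[R]_n) = 1%:M.
Proof.
apply: lim_near_cst; first exact: norm_hausdorff.
near=> N; have N0 : (0 < N)%N by near: N; exact: nbhs_infty_gt.
rewrite -(prednK N0) /series /= big_nat_recl//= expr0 fact0 invr1 scale1r.
by rewrite big1_seq ?addr0// => j _; rewrite expr0n /= scaler0.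
Unshelve. all: by end_near. Qed.

(** * Derivatives along trajectories *)

Lemma is_derive_mulmx (R : realType) (m n k : nat)
    (F : R -> 'M[R]_(m, n)) (G : R -> 'M[R]_(n, k))
    (dF : 'M[R]_(m, n)) (dG : 'M[R]_(n, k)) (t : R) :
  (forall i j, is_derive t 1 (fun s => F s i j) (dF i j)) ->
  (forall i j, is_derive t 1 (fun s => G s i j) (dG i j)) ->
  forall i j, is_derive t 1 (fun s => (F s *m G s) i j)
    ((dF *m G t + F t *m dG) i j).
Proof.
move=> hF hG i j.
have -> : (fun s => (F s *m G s) i j) =
    \sum_l (fun s => F s i l) * (fun s => G s l j).
  by rewrite fct_sumE; apply/funext => s; rewrite mxE.
rewrite mxE ![(_ *m _) i j]mxE -big_split /=.
apply: is_derive_sum => l.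
apply: is_derive_eq (is_deriveM (hF i l) (hG l j)) _.
by rewrite /GRing.scale /=; ring.
Qed.

Lemma is_derive_state (R : realType) (n : nat) (A : 'M[R]_n) (x0 : 'cV[R]_n)
    (t : R) (i : 'I_n) (j : 'I_1) :
  is_derive t 1 (fun s => (expmx (s *: A) *m x0) i j)
    ((A *m (expmx (t *: A) *m x0)) i j).
Proof.
have hE := is_derive_expmx A t.
have h0 i' j' : is_derive t 1 (fun=> x0 i' j') ((0 : 'cV[R]_n) i' j').
  by rewrite mxE; exact: is_derive_cst.
by have := is_derive_mulmx hE h0 i j; rewrite mulmx0 addr0 mulmxA.
Qed.

Lemma is_derive_quad_form (R : realType) (n : nat) (Q : 'M[R]_n)
    (x : R -> 'cV[R]_n) (dx : 'cV[R]_n) (t : R) :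
  (forall i j, is_derive t 1 (fun s => x s i j) (dx i j)) ->
  is_derive t 1 (fun s => quad_form Q (x s))
    ((dx^T *m Q *m x t + (x t)^T *m Q *m dx) ord0 ord0).
Proof.
move=> hx; rewrite /quad_form.
apply: (@is_derive_mulmx _ _ _ _ (fun s => (x s)^T *m Q)) => // i j.
have hxT : forall i j, is_derive t 1 (fun s => (x s)^T i j) (dx^T i j).
  move=> i' j'; rewrite mxE.
  by under eq_fun do rewrite mxE; exact: hx.
have hQ i' j' : is_derive t 1 (fun=> Q i' j') ((0 : 'M[R]_n) i' j').
  by rewrite mxE; exact: is_derive_cst.
by have := is_derive_mulmx hxT hQ i j; rewrite mulmx0 addr0.
Qed.

(** * An integral bound from a dissipation equation *)

Lemma ge0_integral_le_increment (R : realType) (F f g : R -> R) (T : R) :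
  0 <= T -> (forall t : R, is_derive t 1 F (f t)) ->
  continuous f -> continuous g ->
  (forall t, 0 <= g t <= f t) ->
  (\int[lebesgue_measure]_(t in `[0%R, T]) (g t)%:E <= (F T - F 0)%:E)%E.
Proof.
move=> T0 dF cf cg gf.
have cF : continuous F.
  move=> t; apply/differentiable_continuous/derivable1_diffP.
  by have [] := dF t.
apply: (@le_trans _ _ (\int[lebesgue_measure]_(t in `[0%R, T]) (f t)%:E)%E).
  apply: ge0_le_integral => //.
  - by move=> t _; rewrite lee_fin; have /andP[] := gf t.
  - apply/measurable_realfun.measurable_EFinP/measurable_funTS.
    exact: measurable_realfun.continuous_measurable_fun.
  - apply/measurable_realfun.measurable_EFinP/measurable_funTS.
    exact: measurable_realfun.continuous_measurable_fun.
  - by move=> t _; rewrite lee_fin; have /andP[] := gf t.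
have [->|Tn0] := eqVneq T 0.
  (* [continuous_FTC2] applies to nondegenerate intervals only. *)
  by rewrite set_itv1 integral_set1 subrr.
rewrite (@continuous_FTC2 _ f F) ?EFinB//.
- by rewrite lt_neqAle eq_sym Tn0.
- exact: continuous_subspaceT.
- split=> [t _||]; first by have [] := dF t.
  + by apply: cvg_at_right_filter; exact: cF.
  + by apply: cvg_at_left_filter; exact: cF.
- by move=> t _; rewrite derive1E; have [] := dF t.
Qed.

(** The differential equation says that [expR (alpha * t) * V t] decreases at
    the rate [expR (alpha * t) * y t ^+ 2 / alpha], and the arithmetic-geometric
    mean inequality with the weight [expR (alpha * t) / alpha] bounds [y] by a
    combination of this rate and an integrable exponential. *)
Lemma dissipation_integral_le (R : realType) (alpha : R) (V y : R -> R) (T : R) :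
  0 < alpha -> 0 <= T ->
  (forall t : R, is_derive t 1 V (- (alpha * V t + alpha^-1 * y t ^+ 2))) ->
  continuous y -> (forall t, 0 <= y t) -> (forall t, 0 <= V t) ->
  (\int[lebesgue_measure]_(t in `[0%R, T]) (y t)%:E <= ((1 + V 0) / 2)%:E)%E.
Proof.
move=> a0 T0 dV cy y0 V0.
pose F t := - 2^-1 * (expR (- alpha * t) + expR (alpha * t) * V t).
pose f t := (alpha * expR (- alpha * t)
  + expR (alpha * t) * (alpha^-1 * y t ^+ 2)) / 2.
have dexp (c t : R) : is_derive t 1 (fun s => expR (c * s)) (c * expR (c * t)).
  have dl : is_derive t 1 (fun s : R => c * s) c.
    by apply: is_derive_eq; rewrite /GRing.scale /=; ring.
  by have := is_derive1_comp (is_derive_expR (c * t)) dl; rewrite mulrC.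
have dF (t : R) : is_derive t 1 F (f t).
  have h1 := is_deriveD (dexp (- alpha) t) (is_deriveM (dexp alpha t) (dV t)).
  apply: (is_derive_eq (is_deriveZ (- 2^-1) h1)).
  by rewrite /f /GRing.scale /=; ring.
have cexp (c : R) : continuous (fun s : R => expR (c * s)).
  move=> t; apply/differentiable_continuous/derivable1_diffP.
  by have [] := dexp c t.
have cf : continuous f.
  move=> t; apply: cvgM; last exact: cvg_cst.
  apply: cvgD; first by apply: cvgMl_tmp; exact: cexp.
  apply: cvgM; first exact: cexp.
  by apply: cvgMl_tmp; rewrite expr2; apply: cvgM; exact: cy.
apply: (le_trans (ge0_integral_le_increment T0 dF cf cy _)) => [t|].
  rewrite y0 /= /f mulNr expRN.
  set e := expR (alpha * t); have e0 : 0 < e by exact: expR_gt0.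
  rewrite -subr_ge0.
  (* The gap in the weighted mean inequality is a perfect square. *)
  have -> : (alpha / e + e * (alpha^-1 * y t ^+ 2)) / 2 - y t =
      (alpha - e * y t) ^+ 2 / (2 * alpha * e).
    by field; rewrite !gt_eqF.
  by rewrite divr_ge0 ?sqr_ge0// !mulr_ge0 ?ltW.
rewrite lee_fin /F !mulr0 expR0 mul1r.
have := expR_gt0 (- alpha * T).
have := mulr_ge0 (ltW (expR_gt0 (alpha * T))) (V0 T).
lra.
Qed.

(** * Quadratic forms and output norms *)

Lemma sqr_eucl_norm (R : realType) (k : nat) (y : 'cV[R]_k) :
  eucl_norm y ^+ 2 = (y^T *m y) ord0 ord0.
Proof.
rewrite sqr_sqrtr; last by apply: sumr_ge0 => i _; exact: sqr_ge0.
by rewrite mxE; apply: eq_bigr => i _; rewrite mxE expr2.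
Qed.

Lemma continuous_eucl_norm (R : realType) (k : nat) (y : R -> 'cV[R]_k) :
  (forall i, continuous (fun t => y t i ord0)) ->
  continuous (fun t => eucl_norm (y t)).
Proof.
move=> cy t; rewrite /eucl_norm.
apply: continuous_comp; last exact: sqrt_continuous.
apply: cvg_big => [|i _].
  by move=> *; exact: add_continuous.
by rewrite expr2; apply: cvgM; exact: cy.
Qed.

(** The left-hand side is the derivative of [quad_form Q] along [x' = A x], so
    the matrix equation becomes a scalar differential equation. *)
Lemma lyapunov_quad_form (R : realType) (n k : nat) (A Q : 'M[R]_n)
    (C : 'M[R]_(k, n)) (alpha : R) (x : 'cV[R]_n) :
  Q *m A + A^T *m Q + alpha *: Q + alpha^-1 *: (C^T *m C) = 0 ->
  ((A *m x)^T *m Q *m x + x^T *m Q *m (A *m x)) ord0 ord0 =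
  - (alpha * quad_form Q x + alpha^-1 * eucl_norm (C *m x) ^+ 2).
Proof.
move=> hQ; rewrite sqr_eucl_norm /quad_form; apply/eqP; rewrite -subr_eq0 opprK.
have := congr1 (fun M => (x^T *m M *m x) ord0 ord0) hQ.
rewrite mulmx0 mul0mx [RHS]mxE => <-; apply/eqP.
rewrite !mulmxDr !mulmxDl -!scalemxAr -!scalemxAl !trmx_mul !mulmxA.
rewrite ![fun_of_matrix (_ + _) _ _]mxE ![fun_of_matrix (_ *: _) _ _]mxE.
ring.
Qed.

Unset Implicit Arguments.

Theorem theorem2 (R : realType) (n m k : nat)
    (A : 'M[R]_n) (B : 'M[R]_(n, m)) (C : 'M[R]_(k, n))
    (hA : stable A)
    (hAB : controllable A B)
    (hCA : observable C A)
    (hB : \rank B = m)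
    (hC : \rank C = k)
    (alpha : R) (halpha : 0 < alpha)
    (Q : 'M[R]_n) (hQsym : Q^T = Q) (hQpos : pos_def Q)
    (hQ : Q *m A + A^T *m Q + alpha *: Q + alpha^-1 *: (C^T *m C) = 0) :
  [set x : 'cV[R]_n | quad_form Q x <= 1] `<=` hardly_observable1 C A.
Proof.
move=> x0 /= hx0 T /= T0; rewrite /hardly_observable1_upto /=.
pose x t := expmx (t *: A) *m x0.
have dx (t : R) i j : is_derive t 1 (fun s => x s i j) ((A *m x t) i j).
  exact: is_derive_state.
have outE t : output C A x0 t = C *m x t by rewrite /output mulmxA.
have V_ge0 t : 0 <= quad_form Q (x t).
  have [->|xt0] := eqVneq (x t) 0; last exact/ltW/hQpos.
  by rewrite /quad_form mulmx0 mxE.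
have dV (t : R) : is_derive t 1 (fun s => quad_form Q (x s))
    (- (alpha * quad_form Q (x t)
        + alpha^-1 * eucl_norm (output C A x0 t) ^+ 2)).
  rewrite outE -(lyapunov_quad_form _ hQ).
  exact: is_derive_quad_form (dx t).
have cy : continuous (fun t => eucl_norm (output C A x0 t)).
  apply: continuous_eucl_norm => i t; under eq_fun do rewrite outE mxE.
  apply: cvg_big => [|j _]; first by move=> *; exact: add_continuous.
  apply: cvgMl_tmp; apply/differentiable_continuous/derivable1_diffP.
  by have [] := dx t j ord0.
apply: le_trans (dissipation_integral_le halpha T0 dV cy _ V_ge0) _ => [t|].
  exact: sqrtr_ge0.
have -> : x 0 = x0 by rewrite /x scale0r expmx0 mul1mx.
by rewrite lee_fin; lra.
Qed.
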